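(* If $T_1$ and $T_2$ are any two trees on the same set of $n$ vertices such that $T_1$ and $T_2$ have exactly $k$ edges in common, where $k>n/2$, then $$\dim(T_1)-2(n-k-1)\le \dim(T_2)\le \dim(T_1)+2(n-k-1).$$
   Context: All graphs are finite and simple. For a connected graph $G=(V,E)$, $d_G(x,y)$ denotes the length of a shortest path between $x$ and $y$ in $G$. A vertex $v$ resolves two vertices $x,y$ if $d_G(v,x)\ne d_G(v,y)$. A set $S\subseteq V$ is a metric generator for $G$ if every pair of distinct vertices of $G$ is resolved by some element of $S$; the metric dimension $\dim(G)$ is the minimum cardinality of a metric generator for $G$. *)

(* Defs.v *)
From mathcomp Require Import all_boot.

Set Implicit Arguments.
Unset Strict Implicit.
Unset Printing Implicit Defensive.

Section Graphs.

Variable V : finType.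
Implicit Types (e : rel V) (x y v : V) (S : {set V}).

(* A simple graph on the vertex set V is given by its adjacency relation. *)
Definition simple_graph e : Prop := symmetric e /\ irreflexive e.

Definition connected_graph e : Prop :=
  0 < #|V| /\ forall x y, connect e x y.

Definition acyclic e : Prop := forall c : seq V, 2 < size c -> ~ ucycle e c.

Definition is_tree e : Prop :=
  [/\ simple_graph e, connected_graph e & acyclic e].

Definition edges e : {set {set V}} := [set [set x; y] | x in V, y in V & e x y].

Definition walk_of_length e x y m : bool :=
  [exists p : m.-tuple V, path e x p && (last x p == y)].

(* The least m < #|V| such that some walk of length m joins x to y; a shortest
   path has fewer than #|V| edges, so the default value #|V| is only taken when
   x and y are not connected (see distP). *)
Definition dist e x y : nat := find (walk_of_length e x y) (iota 0 #|V|).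

Definition resolves e v x y : bool := dist e v x != dist e v y.

Definition metric_generator e S : bool :=
  [forall x, forall y, (x != y) ==> [exists v in S, resolves e v x y]].

(* The whole vertex set is a metric generator (metric_generatorT), so the
   minimum ranges over a nonempty family. *)
Definition metric_dim e : nat :=
  #|[arg min_(S < [set: V] | metric_generator e S) #|S|]|.

Lemma walkP e x y m :
  reflect (exists p, [/\ path e x p, last x p = y & size p = m])
          (walk_of_length e x y m).
Proof.
apply: (iffP existsP) => [[p /andP[pp /eqP lp]]|[p [pp lp /eqP sp]]].
  by exists p; rewrite size_tuple.
by exists (Tuple sp); rewrite /= pp lp eqxx.
Qed.

Lemma distP e x y : connect e x y ->
  (exists p, [/\ path e x p, last x p = y & size p = dist e x y]) /\
  (forall p, path e x p -> last x p = y -> dist e x y <= size p).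
Proof.
move=> /connectP[p0 pp0 lp0].
have hasw : has (walk_of_length e x y) (iota 0 #|V|).
  case: (shortenP pp0) lp0 => p pp up _ lp.
  apply/hasP; exists (size p); last by apply/walkP; exists p.
  by rewrite mem_iota add0n -ltnS -[(size p).+1]/(size (x :: p)) ltnS
             -(card_uniqP up) max_card.
have dlt : dist e x y < #|V| by move: hasw; rewrite has_find size_iota.
split=> [|p pp lp].
  by have := nth_find 0 hasw; rewrite nth_iota // add0n => /walkP.
rewrite leqNgt; apply/negP => lt_p.
have := before_find 0 lt_p; rewrite nth_iota ?(ltn_trans lt_p) // add0n.
by move/negbT/negP; apply; apply/walkP; exists p.
Qed.

Lemma dist_eq0 e x y : (dist e x y == 0) = (x == y).
Proof.
have V0 : 0 < #|V| by apply/card_gt0P; exists x.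
rewrite /dist -(prednK V0) /=; case: ifP => [/walkP[p [_ lp /size0nil p0]]|] /=.
  by rewrite -lp p0 !eqxx.
move=> /negbT/negP H; apply/esym/negP => /eqP xy; apply: H.
by apply/walkP; exists [::].
Qed.

Lemma metric_generatorT e : metric_generator e [set: V].
Proof.
apply/forallP => x; apply/forallP => y; apply/implyP => xy.
apply/existsP; exists x; rewrite inE /resolves.
have /eqP -> : dist e x x == 0 by rewrite dist_eq0.
by rewrite eq_sym dist_eq0.
Qed.

Lemma metric_dimP e :
  (exists2 S, metric_generator e S & #|S| = metric_dim e) /\
  (forall S, metric_generator e S -> metric_dim e <= #|S|).
Proof.
rewrite /metric_dim; case: arg_minnP => [|S gS minS].
  exact: metric_generatorT.
by split=> //; exists S.
Qed.

End Graphs.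

(* Main.v *)
Require Import Defs.
From mathcomp Require Import all_boot all_order all_algebra.
From mathcomp Require Import zify.
Import Order.TTheory GRing.Theory Num.Theory.
Local Open Scope ring_scope.

(** Let [F] be the forest of the edges common to [T1] and [T2], let [S] be a
    metric generator of [T1], and let [B] be the set of endpoints of the edges
    of [T1] outside [T2].  Then [S :|: B] is a metric generator of [T2].  Since
    a tree on [n] vertices has at most [n - 1] edges, [B] has at most
    [2 * (n - 1 - k)] elements, which is one of the two bounds; the other one
    follows by exchanging the trees.

    Everything rests on the uniqueness of simple paths in a tree
    ([tree_path_uniq]).  It shows that inside a component of [F] the distances
    in [T1], [T2] and [F] agree ([tree_dist_subgraph]), and that all
    simple paths of a tree between two components [C] and [D] of [F] leave [C] through
    one vertex [c] and enter [D] through one vertex [d] ([tree_bridge]); for the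
    tree [T1] the exit [c] lies in [B].  In particular, if [F] is disconnected,
    each of its components meets [B].

    Consider two distinct vertices [x] and [y].
    - If they lie in the same component [C] of [F], some [s] in [S] resolves
      them in [T1].  If [s] is in [C] it resolves them in [T2] as well, because
      the distances involved are the same.  Otherwise the paths of [T1] from
      [s] enter [C] through one vertex of [B], which therefore resolves [x] and
      [y] in [T1], hence in [T2].
    - If they lie in different components [C] and [D], choose [a] in [B] and in
      [C], and [b] in [B] and in [D], and let [c] and [d] be the exits for
      [T2].  If [a] did not resolve [x] and [y] in [T2], then [x] would be
      further from [c] than [y] is from [d]; if [b] did not, the converse would
      hold.  So one of [a] and [b] resolves them ([bridge_resolves]). *)

(** * Distances in connected graphs *)

Section Dist.

Context {V : finType} {e : rel V}.
Hypotheses (e_sym : symmetric e) (e_conn : forall x y, connect e x y).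

Lemma geodesic x y :
  exists p, [/\ path e x p, last x p = y & size p = dist e x y].
Proof. by have [] := distP (e_conn x y). Qed.

Lemma dist_le_size x p : path e x p -> (dist e x (last x p) <= size p)%N.
Proof. by move=> pp; have [_ /(_ p pp erefl)] := distP (e_conn x (last x p)). Qed.

(** A walk that repeats a vertex can be shortened. *)
Lemma geodesic_uniq x p :
  path e x p -> size p = dist e x (last x p) -> uniq (x :: p).
Proof.
move=> pp sp; case: (shortenP pp) (sp) => q pq uq sub_q sp'.
have pq_size : (size (x :: p) <= size (x :: q))%N.
  by rewrite /= sp' ltnS dist_le_size.
apply: (leq_size_uniq uq) pq_size => z.
by rewrite !inE => /orP[->//|/sub_q ->]; exact: orbT.
Qed.

Lemma dist_triangle x y z : (dist e x z <= dist e x y + dist e y z)%N.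
Proof.
have [p [pp lp <-]] := geodesic x y; have [q [pq lq <-]] := geodesic y z.
have: path e x (p ++ q) by rewrite cat_path pp lp.
by move/dist_le_size; rewrite last_cat lp lq size_cat.
Qed.

Lemma dist_sym x y : dist e x y = dist e y x.
Proof.
suff le a b : (dist e b a <= dist e a b)%N by apply/eqP; rewrite eqn_leq !le.
have [p [pp lp <-]] := geodesic a b.
have: path e (last a p) (rev (belast a p)).
  by rewrite rev_path; apply: sub_path pp => u v; rewrite e_sym.
move/dist_le_size; rewrite size_rev size_belast lp.
suff -> : last b (rev (belast a p)) = a by [].
by case: p lp {pp} => [|u p] //= _; rewrite rev_cons last_rcons.
Qed.

Lemma dist_edge r x y : e x y -> (dist e r y <= (dist e r x).+1)%N.
Proof.
move=> exy; have [p [pp lp <-]] := geodesic r x.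
have: path e r (rcons p y) by rewrite rcons_path pp lp.
by move/dist_le_size; rewrite last_rcons size_rcons.
Qed.

(** Suppose every geodesic between [C] and [D] runs through [c] and [d].  If
    neither [a] in [C] nor [b] in [D] resolved [x] in [C] and [y] in [D], then
    [x] would be further from [c] than [y] is from [d], and conversely. *)
Lemma bridge_resolves (C D : pred V) c d a b x y :
    C c -> D d -> c != d ->
    (forall u v, C u -> D v ->
       dist e u v = dist e u c + dist e c d + dist e d v)%N ->
    C a -> C x -> D b -> D y ->
  resolves e a x y || resolves e b x y.
Proof.
move=> Cc Dd cd br Ca Cx Db Dy; rewrite /resolves -negb_and.
apply/negP => /andP[/eqP ax /eqP bx].
have cd_gt0 : (0 < dist e c d)%N by rewrite lt0n dist_eq0.
have := dist_triangle a c x; have := dist_triangle b d y.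
have := br _ _ Ca Dy; have := br _ _ Cx Db.
by rewrite (dist_sym x b) (dist_sym d b) (dist_sym x c); lia.
Qed.

End Dist.

(** * Simple paths in trees *)

(** If two simple paths from [x] to the same vertex start with distinct
    neighbours [u] and [v] of [x], then [u] and [v] are connected in the graph
    without [x], and a simple path between them there closes up to a cycle
    through [x]. *)
Lemma acyclic_path_uniq (V : finType) (e : rel V) x p q :
    symmetric e -> acyclic e ->
    path e x p -> path e x q -> last x p = last x q ->
    uniq (x :: p) -> uniq (x :: q) ->
  p = q.
Proof.
move=> e_sym e_acy.
have no_loop (z : V) s : last z s = z -> uniq (z :: s) -> s = [::].
  by case: s => //= w s <-; rewrite mem_last.
elim: p x q => [|u p IHp] x [|v q] //.
- by move=> _ _ /esym lq _ uq; rewrite (no_loop _ _ lq uq).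
- by move=> _ _ lp up _; rewrite (no_loop _ _ lp up).
move=> /= /andP[exu pp] /andP[exv pq] lpq /andP[xp up] /andP[xq uq].
have [uv|uv] := eqVneq u v.
  by subst v; congr (_ :: _); apply: (IHp u).
(* [e'] is the graph without [x]. *)
pose e' := [rel a b | [&& e a b, a != x & b != x]].
have e'_sym : connect_sym e'.
  by apply/sym_connect_sym => a b /=; rewrite e_sym; case: (a == x); case: (b == x).
have away w s : path e w s -> x \notin w :: s -> connect e' w (last w s).
  move=> ps xs; apply/connectP; exists s => //.
  elim: s w ps xs => //= z s IHs w /andP[ewz ps].
  rewrite !inE !negb_or => /and3P[xw xz xs].
  by rewrite ewz eq_sym xw eq_sym xz IHs // inE negb_or xz.
have: connect e' u v.
  by apply: (connect_trans (away _ _ pp xp)); rewrite lpq e'_sym away.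
case/connectP=> r0 pr0 lr0; case: (shortenP pr0) lr0 => r pr ur _ lr {r0 pr0}.
have sub_e : subrel e' e by move=> a b /andP[].
have xr : x \notin u :: r.
  rewrite inE negb_or; move: xp; rewrite inE negb_or => /andP[-> _] /=.
  apply/negP; move: pr; clear; elim: r u => //= z r IHr w /andP[/and3P[_ _ zx] pr].
  by rewrite inE eq_sym (negbTE zx); apply: IHr pr.
case: (e_acy [:: x, u & r]).
  by case: r lr {pr ur xr} uv => //= ->; rewrite eqxx.
apply/andP; split; last by rewrite cons_uniq xr.
by rewrite /= rcons_path exu (sub_path sub_e pr) -lr e_sym exv.
Qed.

Section Tree.

Context {V : finType} {T : rel V}.
Hypothesis T_tree : is_tree T.

Lemma tree_sym : symmetric T. Proof. by case: T_tree => [[]]. Qed.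
Lemma tree_irr : irreflexive T. Proof. by case: T_tree => [[]]. Qed.
Lemma tree_conn x y : connect T x y. Proof. by case: T_tree => _ []. Qed.

Lemma tree_path_uniq x p q :
    path T x p -> path T x q -> last x p = last x q ->
    uniq (x :: p) -> uniq (x :: q) ->
  p = q.
Proof. by apply: acyclic_path_uniq; [exact: tree_sym | case: T_tree]. Qed.

(** A geodesic is simple, so it is the only simple path between its ends. *)
Lemma tree_simple_size x p :
  path T x p -> uniq (x :: p) -> dist T x (last x p) = size p.
Proof.
move=> pp up; have [q [pq lq sq]] := geodesic tree_conn x (last x p).
have uq : uniq (x :: q) by apply: (geodesic_uniq tree_conn); rewrite ?lq.
by rewrite -sq (tree_path_uniq x q p).
Qed.

(** If [y] is not on the geodesic from [r] to [x], appending [y] to it gives a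
    simple path; if it is, then [r] is closer to [y] than to [x]. *)
Lemma tree_dist_edge r x y :
  T x y -> dist T r y = (dist T r x).+1 \/ dist T r x = (dist T r y).+1.
Proof.
move=> Txy; have [p [pp lp sp]] := geodesic tree_conn r x.
have up : uniq (r :: p) by apply: (geodesic_uniq tree_conn); rewrite ?lp.
have [yp|yp] := boolP (y \in r :: p); last first.
  left; have: path T r (rcons p y) by rewrite rcons_path pp lp.
  move/tree_simple_size; rewrite last_rcons size_rcons sp; apply.
  by rewrite -rcons_cons rcons_uniq yp.
right; apply/eqP; rewrite eqn_leq (dist_edge tree_conn) 1?tree_sym //=.
case/splitPl: yp pp lp sp {up} => p1 p2 lp1.
rewrite cat_path lp1 last_cat lp1 => /andP[pp1 _] lp2.
rewrite size_cat => <-; case: p2 lp2 => [/= xy|z p2 _].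
  by move: Txy; rewrite xy tree_irr.
by rewrite /= addnS ltnS -{1}lp1 (leq_trans (dist_le_size tree_conn _ _ pp1)) ?leq_addr.
Qed.

(** Geodesics from [r] to [u] and to [x] both extend to geodesics from [r] to
    [y], which coincide. *)
Lemma tree_parent_uniq r u x y :
    T u y -> T x y ->
    dist T r y = (dist T r u).+1 -> dist T r y = (dist T r x).+1 ->
  u = x.
Proof.
have to_y w : T w y -> dist T r y = (dist T r w).+1 ->
    exists p, [/\ path T r (rcons p y), last r p = w & uniq (r :: rcons p y)].
  move=> Twy dw; have [p [pp lp sp]] := geodesic tree_conn r w.
  have ppy : path T r (rcons p y) by rewrite rcons_path pp lp.
  exists p; split=> //; apply: (geodesic_uniq tree_conn) => //.
  by rewrite last_rcons size_rcons sp.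
move=> Tuy Txy /(to_y _ Tuy)[p [pp <- up]] /(to_y _ Txy)[q [pq <- uq]].
have: rcons p y = rcons q y by apply: (tree_path_uniq r); rewrite ?last_rcons.
by move/rcons_inj => [->].
Qed.

(** After a root is chosen, each edge joins a vertex other than the root to its
    parent, so there are at most as many edges as such vertices. *)
Lemma card_tree_edges : (#|edges T| < #|V|)%N.
Proof.
have [/card_gt0P[r _] _] : connected_graph T by case: T_tree.
pose par v := odflt v [pick u | T u v && (dist T r v == (dist T r u).+1)].
have parE x y : T x y -> dist T r y = (dist T r x).+1 -> par y = x.
  move=> Txy dxy; rewrite /par; case: pickP => [u /andP[Tuy /eqP duy]|/(_ x)] /=.
    exact: (tree_parent_uniq r u x y).
  by rewrite Txy dxy eqxx.
have dr0 : dist T r r = 0%N by apply/eqP; rewrite dist_eq0.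
suff /subset_leq_card le : edges T \subset [set [set v; par v] | v in [set~ r]].
  by rewrite (leq_ltn_trans le) // (leq_ltn_trans (leq_imset_card _ _)) //
             cardsC1 prednK //; apply/card_gt0P; exists r.
apply/subsetP => _ /imset2P[x y _ /[!inE] Txy ->]; apply/imsetP.
have [dxy|dxy] := tree_dist_edge r x y Txy.
- exists y; last by rewrite (parE x y) // setUC.
  by rewrite !inE; apply/eqP => yr; rewrite yr dr0 in dxy.
- exists x; last by rewrite (parE y x) // tree_sym.
  by rewrite !inE; apply/eqP => xr; rewrite xr dr0 in dxy.
Qed.

(** * Components of a subgraph of a tree *)

Section Subgraph.

Context {F : rel V}.
Hypotheses (F_sym : symmetric F) (sub_F : subrel F T).

Lemma path_connect x p z : path F x p -> z \in x :: p -> connect F x z.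
Proof.
move=> pp zp; case/splitPl: zp pp => p1 p2 lp1; rewrite cat_path => /andP[pp1 _].
by apply/connectP; exists p1.
Qed.

Lemma simple_path x y : connect F x y ->
  exists p, [/\ path F x p, last x p = y & uniq (x :: p)].
Proof. by case/connectP=> p0 /shortenP[p pp up _] ->; exists p. Qed.

(** A simple path of [F] is the simple path of [T] between its ends. *)
Lemma tree_dist_subgraph x y : connect F x y -> dist T x y = dist F x y.
Proof.
move=> Fxy; have [[p [pp lp sp]] Fmin] := distP Fxy.
apply/eqP; rewrite eqn_leq -{1}sp -{1}lp (dist_le_size tree_conn) /=; last first.
  exact: sub_path pp.
have [q [pq lq uq]] := simple_path x y Fxy.
by rewrite -lq tree_simple_size ?(sub_path sub_F) // lq Fmin.
Qed.

(** Choose [c] in the component of [x0] and [d] in that of [y0] as close to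
    each other as possible.  A geodesic from [c] to [d] meets these components
    only at its ends, so it extends by simple paths of [F] on both sides to a
    simple path, which is therefore a geodesic.  The first edge of the geodesic
    from [c] to [d] leaves the component of [x0], hence is not in [F]. *)
Lemma tree_bridge x0 y0 : ~~ connect F x0 y0 ->
  exists c d, [/\ connect F x0 c, connect F y0 d,
    exists u, T c u && ~~ F c u &
    forall x y, connect F x0 x -> connect F y0 y ->
      dist T x y = (dist T x c + dist T c d + dist T d y)%N].
Proof.
move=> nF; have F_csym : connect_sym F by apply: sym_connect_sym.
pose P cd := connect F x0 cd.1 && connect F y0 cd.2.
have P0 : P (x0, y0) by rewrite /P !connect0.
case: (@arg_minnP _ (x0, y0) P (fun cd => dist T cd.1 cd.2) P0).
move=> [c d] /andP[/= x0c y0d] min_cd; exists c, d.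
have disj z : connect F x0 z -> connect F y0 z -> False.
  by move=> xz yz; case/negP: nF; rewrite (connect_trans xz) // F_csym.
have [p [pp lp sp]] := geodesic tree_conn c d.
have up : uniq (c :: p) by apply: (geodesic_uniq tree_conn); rewrite ?lp.
have C_p z : connect F x0 z -> z \notin p.
  move=> x0z; apply/negP => zp; case/splitPr: zp pp lp sp => p1 p2 pp lp sp {up}.
  have := min_cd (z, d); rewrite /P /= x0z y0d -sp size_cat => /(_ isT).
  move: pp lp; rewrite cat_path last_cat /= => /and3P[_ _ pp2] <-.
  by have := dist_le_size tree_conn _ _ pp2; lia.
have D_p z : connect F y0 z -> z \in p -> z = d.
  move=> y0z zp; case/splitPr: zp pp lp sp => p1 p2 pp lp sp {up C_p}.
  have := min_cd (c, z); rewrite /P /= x0c y0z -sp size_cat => /(_ isT) /=.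
  move: pp lp; rewrite -cat_rcons cat_path last_cat last_rcons => /andP[pp1 _].
  have := dist_le_size tree_conn _ _ pp1; rewrite last_rcons size_rcons.
  by case: p2 {sp} => //= w p2; lia.
split=> //.
  case: p pp lp C_p {sp up D_p} => [_ /= cd|u p /= /andP[Tcu _] _ C_p].
    by case: (disj c) => //; rewrite cd.
  exists u; rewrite Tcu; apply/negP => Fcu.
  by have := C_p u (connect_trans x0c (connect1 Fcu)); rewrite mem_head.
move=> x y x0x y0y.
have xc : connect F x c by apply: connect_trans x0c; rewrite F_csym.
have dy : connect F d y by apply: connect_trans y0y; rewrite F_csym.
have [q [pq lq uq]] := simple_path x c xc.
have [r [pr lr ur]] := simple_path d y dy.
have inC z : z \in x :: q -> connect F x0 z.
  by move/(path_connect _ _ _ pq); apply: connect_trans.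
have inD z : z \in d :: r -> connect F y0 z.
  by move/(path_connect _ _ _ pr); apply: connect_trans.
have pqT : path T x q by apply: sub_path pq.
have prT : path T d r by apply: sub_path pr.
have: path T x (q ++ p ++ r) by rewrite !cat_path lq pqT pp lp.
move/tree_simple_size; rewrite !last_cat lq lp lr !size_cat => ->.
  by rewrite -{1}lq -lr !tree_simple_size ?sp ?addnA //; rewrite lq.
rewrite -cat_cons cat_uniq uq cat_uniq.
move: up ur => /= /andP[_ ->] /andP[d_r ->]; rewrite andbT /=.
apply/andP; split; apply/hasPn => z.
- rewrite mem_cat => /orP[zp|zr]; apply/negP => /inC x0z.
    by have := C_p z x0z; rewrite zp.
  by apply: (disj z x0z); apply: inD; rewrite inE zr orbT.
- move=> zr; apply/negP => zp; have y0z : connect F y0 z.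
    by apply: inD; rewrite inE zr orbT.
  by move: d_r; rewrite -(D_p z y0z zp) zr.
Qed.

End Subgraph.

End Tree.

(** * Comparing two trees *)

Lemma mem_edges (V : finType) (e : rel V) x y :
  symmetric e -> ([set x; y] \in edges e) = e x y.
Proof.
move=> e_sym; apply/imset2P/idP => [[a b _]|exy]; last first.
  by exists x y; rewrite ?inE.
rewrite inE /= => eab E.
have xab : x \in [set a; b] by rewrite -E set21.
have yab : y \in [set a; b] by rewrite -E set22.
have axy : a \in [set x; y] by rewrite E set21.
have bxy : b \in [set x; y] by rewrite E set22.
case/set2P: xab axy bxy => ->; case/set2P: yab => -> //.
- by move=> _ /set2P[] ba; move: eab; rewrite ba.
- by rewrite e_sym.
- by move=> /set2P[] ab; move: eab; rewrite ab.
Qed.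

Definition endpoints {V : finType} (e1 e2 : rel V) : {set V} :=
  [set x | [exists u, e1 x u && ~~ e2 x u]].

Lemma card_endpoints (V : finType) (e1 e2 : rel V) :
    symmetric e1 -> symmetric e2 ->
  (#|endpoints e1 e2| <= 2 * #|edges e1 :\: edges e2|)%N.
Proof.
move=> sym1 sym2.
apply: (@leq_trans #|cover (edges e1 :\: edges e2)|).
  apply/subset_leq_card/subsetP => x; rewrite inE => /existsP[u /andP[e1xu e2xu]].
  apply/bigcupP; exists [set x; u]; last exact: set21.
  by rewrite inE !mem_edges // e1xu e2xu.
rewrite (leq_trans (leq_card_cover _)) // mulnC -sum_nat_const leq_sum // => A.
by rewrite inE => /andP[_ /imset2P[x y _ _ ->]]; rewrite cards2; case: (_ != _).
Qed.

(** In the component of [x] for the common edges, an element of [S] outside this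
    component can be replaced by the vertex where the paths of [T1] from it
    enter the component; two vertices of different components are
    resolved by one of two endpoints, one taken in each of these components. *)
Lemma tree_generator_transfer (V : finType) (T1 T2 : rel V) (S : {set V}) :
    is_tree T1 -> is_tree T2 -> metric_generator T1 S ->
  metric_generator T2 (S :|: endpoints T1 T2).
Proof.
move=> tree1 tree2 gen1.
pose F := [rel x y | T1 x y && T2 x y].
have F_sym : symmetric F.
  by move=> x y /=; rewrite (tree_sym tree1) (tree_sym tree2).
have F_csym : connect_sym F by apply: sym_connect_sym.
have F1 : subrel F T1 by move=> x y /andP[].
have F2 : subrel F T2 by move=> x y /andP[].
have dist12 u v : connect F u v -> dist T1 u v = dist T2 u v.
  by move=> Fuv; rewrite (tree_dist_subgraph tree1 F1) ?(tree_dist_subgraph tree2 F2).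
have in_B c : (exists u, T1 c u && ~~ F c u) -> c \in endpoints T1 T2.
  case=> u /andP[T1cu]; rewrite /= T1cu /= => nT2.
  by rewrite inE; apply/existsP; exists u; rewrite T1cu.
apply/forallP => x; apply/forallP => y; apply/implyP => xy.
have [Fxy|nFxy] := boolP (connect F x y).
  move/forallP/(_ x)/forallP/(_ y)/implyP/(_ xy)/existsP: gen1 => [s /andP[sS res]].
  have [Fxs|nFxs] := boolP (connect F x s).
    have sx : connect F s x by rewrite F_csym.
    have sy : connect F s y := connect_trans sx Fxy.
    by apply/existsP; exists s; rewrite inE sS /= /resolves -!dist12.
  have [c [d [xc sd cB br]]] := tree_bridge tree1 F_sym F1 x s nFxs.
  apply/existsP; exists c; rewrite inE in_B ?orbT //= /resolves.
  have cx : connect F c x by rewrite F_csym.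
  have cy : connect F c y := connect_trans cx Fxy.
  rewrite -!dist12 //; apply: contraNneq res => eqc.
  have d1sym := dist_sym (tree_sym tree1) (tree_conn tree1).
  rewrite d1sym (d1sym s y) (br x s) // (br y s) //.
  by rewrite (d1sym x c) (d1sym y c) eqc.
have nFyx : ~~ connect F y x by rewrite F_csym.
have [a [_ [xa _ /in_B aB _]]] := tree_bridge tree1 F_sym F1 x y nFxy.
have [b [_ [yb _ /in_B bB _]]] := tree_bridge tree1 F_sym F1 y x nFyx.
have [c [d [xc yd _ br]]] := tree_bridge tree2 F_sym F2 x y nFxy.
have cd : c != d.
  by apply: contraNneq nFxy => cd; rewrite (connect_trans xc) // cd F_csym.
have /orP[res|res] := bridge_resolves (tree_sym tree2) (tree_conn tree2)
  (connect F x) (connect F y) c d a b x y xc yd cd br xa (connect0 _ _) yb (connect0 _ _).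
- by apply/existsP; exists a; rewrite inE aB orbT.
- by apply/existsP; exists b; rewrite inE bB orbT.
Qed.

Lemma tree_metric_dim_le (V : finType) (T1 T2 : rel V) :
    is_tree T1 -> is_tree T2 ->
  (metric_dim T2 <= metric_dim T1 + 2 * #|edges T1 :\: edges T2|)%N.
Proof.
move=> tree1 tree2; have [[S gen1 <-] _] := metric_dimP T1.
have [_ min2] := metric_dimP T2.
apply: leq_trans (min2 _ (tree_generator_transfer _ _ _ _ tree1 tree2 gen1)) _.
rewrite (leq_trans (leq_card_setU _ _).1) // leq_add2l.
by rewrite card_endpoints //; apply: tree_sym.
Qed.

Theorem corollary5p5 (V : finType) (T1 T2 : rel V) (n k : nat)
  (hT1 : is_tree T1) (hT2 : is_tree T2)
  (hn : #|V| = n)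
  (hcommon : #|edges T1 :&: edges T2| = k)
  (hk : (n < 2 * k)%N) :
  (metric_dim T1)%:Z - 2 * (n%:Z - k%:Z - 1) <= (metric_dim T2)%:Z
    <= (metric_dim T1)%:Z + 2 * (n%:Z - k%:Z - 1).
Proof.
have le21 := tree_metric_dim_le _ _ _ hT1 hT2.
have le12 := tree_metric_dim_le _ _ _ hT2 hT1.
have card1 := card_tree_edges hT1; have card2 := card_tree_edges hT2.
have split1 := cardsID (edges T2) (edges T1).
have split2 := cardsID (edges T1) (edges T2).
rewrite setIC in split2; rewrite hcommon in split1 split2.
by apply/andP; split; lia.
Qed.
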